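(* Let $\Pi$ be a poset on $d$ elements and let $O_{\Pi}$ be its order polytope (of dimension $d$). Let $h_{\Pi}(z)$ be the numerator polynomial of the Ehrhart series of the open polytope $O_{\Pi}^{\circ}$, i.e. such that $$\mathrm{Ehr}_{O_{\Pi}^{\circ}}(z) = \frac{h_{\Pi}(z)}{(1-z)^{d+1}}.$$ Then $h_{\Pi}$ can be decomposed as $h_{\Pi}(z) = a_{\Pi}(z) + z\, b_{\Pi}(z)$, where $a_{\Pi}$ and $b_{\Pi}$ are polynomials satisfying $a_{\Pi}(z) = z^{d+1} a_{\Pi}\left(\frac{1}{z}\right)$ and $b_{\Pi}(z) = z^{d} b_{\Pi}\left(\frac{1}{z}\right)$, and such that $b_{\Pi}(z)$ and $-a_{\Pi}(z)$ have nonnegative coefficients.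
   Context: For a poset $\Pi$ on elements $p_1, \ldots, p_d$ with order $\le_{\Pi}$, the order polytope is $$O_{\Pi} = \{x \in \mathbb{R}^d : 0 \le x_i \le 1 \text{ for all } i, \text{ and } x_i \le x_j \text{ whenever } p_i \le_{\Pi} p_j\},$$ a $d$-dimensional polytope with vertices in $\mathbb{Z}^d$. $O_{\Pi}^{\circ}$ denotes its interior, $\mathrm{L}_{O_{\Pi}^{\circ}}(n)$ is the number of points of $\mathbb{Z}^d$ in the interior of $n O_{\Pi}$, and $\mathrm{Ehr}_{O_{\Pi}^{\circ}}(z) = \sum_{n=1}^{\infty} \mathrm{L}_{O_{\Pi}^{\circ}}(n) z^n$. *)

(* Defs.v *)
From HB Require Import structures.
From mathcomp Require Import all_boot all_order all_algebra finmap.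
From mathcomp Require Import all_classical all_reals all_analysis.
Set Implicit Arguments.
Unset Strict Implicit.
Unset Printing Implicit Defensive.
Import Order.TTheory GRing.Theory Num.Theory.
Import numFieldNormedType.Exports.
Local Open Scope classical_set_scope.
Local Open Scope ring_scope.

Section OrderPolytope.
Variables (R : realType) (disp : Order.disp_t) (P : finPOrderType disp).
Variables (d : nat) (p : 'I_d -> P).

Definition order_polytope : set 'rV[R]_d :=
  [set x : 'rV[R]_d | (forall i, 0 <= x ord0 i <= 1) /\
                      (forall i j, (p i <= p j)%O -> x ord0 i <= x ord0 j)].

End OrderPolytope.

Arguments order_polytope R {disp P d} p _.

Section Ehrhart.
Variables (R : realType) (d : nat).
Implicit Types A : set 'rV[R]_d.

Definition dilate (n : nat) A : set 'rV[R]_d := [set n%:R *: x | x in A].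

Definition lattice_points A : set 'rV[int]_d :=
  [set v : 'rV[int]_d | A (map_mx intr v)].

Lemma finite_lattice_points A (n : nat) :
  (forall x, A x -> forall i, `|x ord0 i| <= n%:R) ->
  finite_set (lattice_points A).
Proof.
move=> An.
pose f (g : {ffun 'I_d -> 'I_(n + n).+1}) : 'rV[int]_d :=
  \row_i ((g i)%:Z - n%:Z).
apply: (@sub_finite_set _ _ (range f)); last first.
  by apply: finite_image; exact: finite_finset.
move=> v /An vn.
have vi i : - n%:Z <= v ord0 i <= n%:Z.
  have := vn i; rewrite mxE -intr_norm -[n%:R]/((n%:Z)%:~R) ler_int.
  by rewrite ler_norml.
exists [ffun i => inord `|(v ord0 i + n%:Z)%R|%N] => //.
apply/rowP => i; rewrite !mxE ffunE.
have /andP[lo hi] := vi i.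
have ge0 : 0 <= v ord0 i + n%:Z by rewrite -lerBlDr sub0r.
rewrite inordK; first by rewrite gez0_abs// addrK.
by rewrite ltnS -lez_nat gez0_abs// PoszD lerD2r.
Qed.

(* [fset_set] is [fset0] on infinite sets; [finite_lattice_points] rules this
   out when A is bounded. *)
Definition open_ehrhart A (n : nat) : nat :=
  #|` fset_set (lattice_points (interior (dilate n A)))|.

(* Formal power series over R are represented by their coefficient sequences.
   The series starts at n = 1. *)
Definition open_ehrhart_series A : nat -> R :=
  fun n => if n == 0%N then 0 else (open_ehrhart A n)%:R.

Definition fps_mul (f g : nat -> R) : nat -> R :=
  fun n => \sum_(i < n.+1) f i * g (n - i)%N.

Definition fps_of_poly (q : {poly R}) : nat -> R := fun n => q`_n.

(* f = h / q in R[[z]], for q with invertible constant term. *)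
Definition fps_is_quotient (f : nat -> R) (h q : {poly R}) : Prop :=
  fps_mul (fps_of_poly q) f = fps_of_poly h.

End Ehrhart.

(* Main.v *)
Require Import Defs.
From HB Require Import structures.
From mathcomp Require Import all_boot all_order all_algebra finmap.
From mathcomp Require Import all_classical all_reals all_analysis.
From mathcomp Require Import zify ring lra.
Set Implicit Arguments.
Unset Strict Implicit.
Unset Printing Implicit Defensive.
Import Order.TTheory GRing.Theory Num.Theory.
Import numFieldNormedType.Exports.
Local Open Scope ring_scope.

(* The lattice points in the interior of [n O_Pi] are the strict order-preserving
   maps from Pi to {1, ..., n-1}.  By Stanley's theory of P-partitions, the weak
   maps to [0, m] have generating function q(z) / (1 - z)^(d+1) with q >= 0, and
   the strict maps to [0, m-1] have numerator q'(z) = z^d q(1/z); so h = z q'.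
   Put g = (q - q') / (1 - z): then a = -z g and b = z g + q satisfy
   h = a + z b and both symmetries, and it remains to show g >= 0.

   Weak and strict maps are the extreme cases of P-partitions for a labelling:
   a linear extension, respectively its reverse.  Bubble-sort the former into
   the latter.  Each transposition of neighbours u, v with u < v in Pi loses the
   partitions with f u = f v, which are the partitions of the poset with u and v
   identified: their numerator over (1 - z)^d is nonnegative.  The numerators
   lost add up to some r >= 0, and g = q + z r (for d > 0). *)

(** * P-partitions with lexicographic tie-breaking *)

Definition strict_total (T : eqType) (lt : rel T) : Prop :=
  [/\ irreflexive lt, transitive lt & forall x y, x != y -> lt x y || lt y x].

Definition tie_lt (c : bool) (a b : nat) : bool := (a < b)%N || (a == b) && c.

Section LexPartitions.
Variables (T : finType) (M : nat).
Implicit Types (E lt : rel T) (S : {set T}) (e : pred T).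
Implicit Types f : {ffun T -> 'I_M.+1}.

(* Maps S -> [0, m], extended by 0 outside S, such that (f x, x) precedes
   (f y, y) lexicographically whenever E x y; the value m is allowed on e only.
   E need be neither transitive nor acyclic.  M only provides a codomain that
   does not depend on m. *)
Definition lex_partitions E lt S e (m : nat) : {set {ffun T -> 'I_M.+1}} :=
  [set f : {ffun T -> 'I_M.+1} |
    [&& [forall x, (x \notin S) ==> (f x == ord0)],
        [forall x, (x \in S) ==> tie_lt (e x) (f x) m] &
        [forall x, forall y, [&& x \in S, y \in S & E x y] ==>
           tie_lt (lt x y) (f x) (f y)]]].

Lemma lex_partitionsP E lt S e m f :
  reflect [/\ forall x, x \notin S -> f x = ord0,
              forall x, x \in S -> tie_lt (e x) (f x) m &
              forall x y, x \in S -> y \in S -> E x y ->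
                tie_lt (lt x y) (f x) (f y)]
          (f \in lex_partitions E lt S e m).
Proof.
rewrite inE; apply: (iffP and3P).
  move=> [/forallP h1 /forallP h2 /forallP h3]; split.
  - by move=> x xS; apply/eqP; exact: (implyP (h1 x)).
  - by move=> x xS; exact: (implyP (h2 x)).
  - move=> x y xS yS xy; have /forallP/(_ y)/implyP := h3 x; apply.
    by rewrite xS yS.
move=> [h1 h2 h3]; split.
- by apply/forallP => x; apply/implyP => xS; rewrite h1.
- by apply/forallP => x; apply/implyP => xS; rewrite h2.
- apply/forallP => x; apply/forallP => y; apply/implyP => /and3P[xS yS xy].
  exact: h3.
Qed.

Lemma eq_lex_partitions E lt lt' S e e' m :
  (forall x, x \in S -> e x = e' x) ->
  (forall x y, x \in S -> y \in S -> E x y -> lt x y = lt' x y) ->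
  lex_partitions E lt S e m = lex_partitions E lt' S e' m.
Proof.
move=> ee ll; apply/setP => f; apply/lex_partitionsP/lex_partitionsP.
  move=> [h1 h2 h3]; split => // [x xS|x y xS yS xy]; first by rewrite -ee ?h2.
  by rewrite -ll ?h3.
move=> [h1 h2 h3]; split => // [x xS|x y xS yS xy]; first by rewrite ee ?h2.
by rewrite ll ?h3.
Qed.

Let below lt f : rel T := fun x y => tie_lt (lt x y) (f x) (f y).

Let below_strict_total lt f : strict_total lt -> strict_total (below lt f).
Proof.
move=> [irr tr tot]; split.
- by move=> x; rewrite /below /tie_lt ltnn eqxx irr.
- move=> y x z; rewrite /below /tie_lt.
  move=> /orP[xy|/andP[/eqP xy lxy]] /orP[yz|/andP[/eqP yz lyz]].
  + by rewrite (ltn_trans xy yz).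
  + by rewrite -yz xy.
  + by rewrite xy yz.
  + by rewrite xy yz eqxx (tr _ _ _ lxy lyz) orbT.
- move=> x y /tot; rewrite /below /tie_lt; case: ltngtP => //= _.
Qed.

Let top lt S f v := [forall x, (x \in S) && (x != v) ==> below lt f x v].

(** An element of [S] with the most elements below it is on top: anything above it would have
    strictly more. *)
Let top_exists lt S f : strict_total lt -> S != finset.set0 ->
  exists2 v, v \in S & top lt S f v.
Proof.
move=> /(below_strict_total f)[irr tr tot] /set0Pn[v0 v0S].
case: (@arg_maxnP _ v0 (mem S) (fun x => #|[set y | below lt f y x]|) v0S).
move=> v vS vmax; exists v => //; apply/forallP => x; apply/implyP => /andP[xS xv].
case/orP: (tot _ _ xv) => // vx.
have := vmax x xS; rewrite /geq /= leqNgt => /negP[]; apply/proper_card/properP; split.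
  by apply/fintype.subsetP => y; rewrite !inE => yv; exact: tr yv vx.
by exists v; rewrite inE // irr.
Qed.

Let top_inj lt S f u v : strict_total lt -> u \in S -> v \in S ->
  top lt S f u -> top lt S f v -> u = v.
Proof.
move=> /(below_strict_total f)[irr tr tot] uS vS /forallP/(_ v) + /forallP/(_ u).
rewrite uS vS /=; case: (eqVneq u v) => //= uv h2 h1.
by have := tr _ _ _ h1 h2; rewrite irr.
Qed.

(** If [v] is on top with value [j], no relation of [E] leaves [v] inside [S], and the other values
    are at most [j], with ties only for elements before [v]. Conversely, when [j] equals [m],
    [edown] makes these ties respect the bound [m]. *)
Let card_top lt E S e m v (j : 'I_M.+1) : strict_total lt ->
  (forall x y, x \in S -> y \in S -> lt x y -> e y -> e x) ->
  v \in S ->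
  #|[set f in lex_partitions E lt S e m | top lt S f v & f v == j]| =
  if [forall y in S, ~~ E v y] && tie_lt (e v) j m
  then #|lex_partitions E lt (S :\ v) (lt^~ v) j| else 0%N.
Proof.
move=> lt_st edown vS; have [irr tr tot] := lt_st.
case: ifP => [/andP[/forall_inP vsink vm]|/negP nvm]; last first.
  apply/eqP; rewrite cards_eq0; apply/eqP/setP => f; rewrite [RHS]inE [LHS]inE.
  apply/negP => /andP[/lex_partitionsP[h1 h2 h3] /andP[/forallP ft /eqP fv]].
  apply: nvm; rewrite -fv h2 // andbT; apply/forall_inP => y yS; apply/negP => Evy.
  have := h3 _ _ vS yS Evy; have [virr vtr vtot] := below_strict_total f lt_st.
  have := ft y; rewrite yS /=; have [->|yv /= yv' vy] := eqVneq y v.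
    by move=> _; have := virr v; rewrite /below => ->.
  by have := vtr _ _ _ yv' vy; rewrite virr.
(* [F] forgets the value at [v], which is known to be [j]. *)
pose F (f : {ffun T -> 'I_M.+1}) : {ffun T -> 'I_M.+1} :=
  [ffun x => if x == v then ord0 else f x].
rewrite -(@card_in_imset _ _ F); last first.
  move=> f g; rewrite !inE => /andP[_ /andP[_ /eqP fv]] /andP[_ /andP[_ /eqP gv]].
  move=> /ffunP fg; apply/ffunP => x; have := fg x; rewrite !ffunE.
  by case: eqVneq => // ->; rewrite fv gv.
congr #|pred_of_set _|; apply/setP => g; apply/imsetP/idP.
  move=> [f]; rewrite inE => /andP[/lex_partitionsP[h1 h2 h3] /andP[/forallP ft /eqP fv] ->].
  apply/lex_partitionsP; split.
  - move=> x; rewrite !inE ffunE; case: eqVneq => //= xv; exact: h1.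
  - move=> x; rewrite !inE ffunE; case: eqVneq => //= xv xS.
    by have := ft x; rewrite xS xv /= /below fv.
  - move=> x y; rewrite !inE !ffunE; case: eqVneq => //= xv xS.
    case: eqVneq => //= yv yS; exact: h3.
move=> /lex_partitionsP[h1 h2 h3].
exists [ffun x => if x == v then j else g x]; last first.
  apply/ffunP => x; rewrite !ffunE; case: eqVneq => // ->.
  by rewrite h1 // !inE eqxx.
rewrite inE ffunE eqxx eqxx andbT; apply/andP; split.
  apply/lex_partitionsP; split.
  - move=> x xS; rewrite ffunE; case: eqVneq => [xv|xv]; first by rewrite xv vS in xS.
    by apply: h1; rewrite !inE xv.
  - move=> x xS; rewrite ffunE; case: eqVneq => [->//|xv].
    have := h2 x; rewrite !inE xv xS => /(_ isT).
    move: vm; rewrite /tie_lt => /orP[jm|/andP[/eqP jm ev]].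
      by move=> /orP[xj|/andP[/eqP -> _]]; rewrite ?jm // (ltn_trans xj jm).
    move=> /orP[xj|/andP[/eqP -> lxv]]; rewrite -jm ?xj // eqxx.
    by rewrite (edown _ _ xS vS lxv ev) orbT.
  - move=> x y xS yS xy; rewrite !ffunE.
    case: eqVneq => [xv|xv].
      by have := vsink y yS; rewrite -xv xy.
    have xS' : x \in S :\ v by rewrite !inE xv.
    case: eqVneq => [->|yv]; first exact: h2.
    by apply: h3 => //; rewrite !inE yv.
apply/forallP => x; apply/implyP => /andP[xS xv]; rewrite /below !ffunE eqxx (negbTE xv).
by apply: h2; rewrite !inE xv.
Qed.

(* Split according to the lexicographically largest pair (f v, v). *)
Lemma card_lex_partitions_rec E lt S e m : (m <= M)%N -> strict_total lt ->
  (forall x y, x \in S -> y \in S -> lt x y -> e y -> e x) -> S != finset.set0 ->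
  #|lex_partitions E lt S e m| =
  (\sum_(v in S | [forall y in S, ~~ E v y])
     \sum_(j < m.+1 | tie_lt (e v) j m)
       #|lex_partitions E lt (S :\ v) (lt^~ v) j|)%N.
Proof.
move=> mM lt_st edown S0; have [v0 v0S] := set0Pn _ S0.
pose tp f := odflt v0 [pick v in S | top lt S f v].
have tpP f : tp f \in S /\ top lt S f (tp f).
  rewrite /tp; case: pickP => [v /andP[] //|] /=.
  by have [v vS vt] := top_exists f lt_st S0; move=> /(_ v); rewrite /= vS vt.
rewrite -sum1_card (partition_big tp (mem S)) /=; last by move=> f _; case: (tpP f).
rewrite [RHS]big_mkcondr /=; apply: eq_bigr => v vS.
rewrite (partition_big (fun f => f v) xpredT) //=.
transitivity (\sum_(j < M.+1) (if [forall y in S, ~~ E v y] && tie_lt (e v) j m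
  then #|lex_partitions E lt (S :\ v) (lt^~ v) j| else 0))%N.
  apply: eq_bigr => j _; rewrite -card_top // -sum1_card; apply: eq_bigl => f.
  rewrite !inE -!andbA; do 3 congr (_ && _); congr (_ && _).
  apply/eqP/idP => [<-|vt]; first by case: (tpP f).
  by have [h1 h2] := tpP f; exact: top_inj h2 vt.
case: ifP => [vs|_]; last by rewrite big1.
rewrite -big_mkcond /= [RHS](big_ord_widen_cond M.+1 (fun j => tie_lt (e v) j m)
  (fun j => #|lex_partitions E lt (S :\ v) (lt^~ v) j|)) //=.
apply: eq_bigl => j; rewrite /tie_lt ltnS.
by case: (ltngtP j m); rewrite ?andbT ?andbF.
Qed.

End LexPartitions.

(** * Division by powers of 1 - z on coefficient sequences *)

Section PartialSums.
Variable V : zmodType.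
Implicit Types a b : nat -> V.

(** On generating functions, [psum] divides by 1 - z and [delay] multiplies by z; so [iter k psum]
    of the coefficients of q expands q / (1 - z)^k. *)
Definition psum a (n : nat) : V := \sum_(i < n.+1) a i.

Definition delay a (n : nat) : V := if n is k.+1 then a k else 0.

Lemma psum_inj a b : psum a = psum b -> a = b.
Proof.
move=> ab; apply/funext => -[|n].
  by have := congr1 (fun c => c 0%N) ab; rewrite /psum !big_ord1.
have h1 := congr1 (fun c => c n.+1) ab; have h0 := congr1 (fun c => c n) ab.
move: h1; rewrite /psum /= big_ord_recr [RHS]big_ord_recr /=.
by rewrite -!/(psum _ n) h0; exact: addrI.
Qed.

Lemma psum_delay a : psum (delay a) = delay (psum a).
Proof.
apply/funext => -[|n]; first by rewrite /psum big_ord1.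
by rewrite /psum big_ord_recl add0r.
Qed.

Lemma iter_psum_delay k a : iter k psum (delay a) = delay (iter k psum a).
Proof. by elim: k => //= k ->; exact: psum_delay. Qed.

Lemma iter_psum_sum k (I : finType) (P : pred I) (F : I -> nat -> V) n :
  iter k psum (fun n => \sum_(i | P i) F i n) n =
  \sum_(i | P i) iter k psum (F i) n.
Proof.
elim: k n => //= k IHk n; rewrite /psum exchange_big /=.
by apply: eq_bigr => i _; exact: IHk.
Qed.

Lemma iter_psumD k a b :
  iter k psum (fun n => a n + b n) = fun n => iter k psum a n + iter k psum b n.
Proof.
by elim: k => //= k ->; apply/funext => n; rewrite /psum big_split.
Qed.

Lemma iter_psumB k a b :
  iter k psum (fun n => a n - b n) = fun n => iter k psum a n - iter k psum b n.
Proof.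
by elim: k => //= k ->; apply/funext => n; rewrite /psum sumrB.
Qed.

(** Forbidding the tie ends the sum at m - 1, which costs one factor z in the generating
    function. *)
Lemma psum_tie (c : bool) a m :
  \sum_(j < m.+1 | tie_lt c j m) a j = psum (if c then a else delay a) m.
Proof.
rewrite /tie_lt; case: c.
  apply: eq_bigl => j; rewrite andbT orbC -leq_eqVlt.
  by rewrite -ltnS ltn_ord.
rewrite psum_delay (eq_bigl (fun j : 'I_m.+1 => (j < m)%N)); last first.
  by move=> j; rewrite andbF orbF.
case: m => [|m]; first by rewrite big1.
rewrite big_mkcond big_ord_recr /= ltnn addr0; apply: eq_bigr => j _.
by rewrite ltn_ord.
Qed.

End PartialSums.

Lemma iter_psum_inj (V : zmodType) k (a b : nat -> V) :
  iter k (@psum V) a = iter k (@psum V) b -> a = b.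
Proof. by elim: k => //= k IHk /psum_inj. Qed.

Lemma psumK (V : zmodType) (a : nat -> V) : psum (fun i => a i - delay a i) = a.
Proof.
have /= -> := iter_psumB 1 a (delay a); rewrite psum_delay; apply/funext => -[|n] /=.
  by rewrite /psum big_ord1 subr0.
by rewrite /psum big_ord_recr /= addrAC subrr add0r.
Qed.

Lemma coefXM_delay (R : nzRingType) (q : {poly R}) :
  (fun i => ('X * q)`_i) = delay (fun i => q`_i).
Proof. by apply/funext => -[|i]; rewrite coefXM. Qed.

(** * Order reversal and reciprocity *)

Section StrictTotal.
Variables (T : eqType) (lt lt' : rel T).
Hypotheses (lt_st : strict_total lt) (lt'E : forall x y, lt' x y = lt y x).

Lemma strict_total_rev : strict_total lt'.
Proof.
have [irr tr tot] := lt_st; split.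
- by move=> x; rewrite lt'E.
- by move=> y x z; rewrite !lt'E => xy yz; exact: tr yz xy.
- by move=> x y /tot; rewrite !lt'E orbC.
Qed.

Lemma strict_total_revN x y : x != y -> lt' x y = ~~ lt x y.
Proof.
have [irr tr tot] := lt_st.
move=> /tot; rewrite lt'E; case: (boolP (lt x y)) => //= xy _.
by apply/negP => yx; have := tr _ _ _ xy yx; rewrite irr.
Qed.

End StrictTotal.

(* Reversing the tie-breaking order and the bound is Stanley reciprocity: it
   exchanges ascents and descents, hence reverses the numerator. *)
Lemma lex_partitions_gf (R : numFieldType) (T : finType) (E lt lt' : rel T)
    (n : nat) (S : {set T}) (e e' : pred T) :
  strict_total lt -> (forall x y, lt' x y = lt y x) -> #|S| = n ->
  (forall x y, x \in S -> y \in S -> lt x y -> e y -> e x) ->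
  (forall x, x \in S -> e' x = ~~ e x) ->
  exists q : {poly R} * {poly R},
    [/\ forall i, 0 <= q.1`_i,
        forall z : R, z != 0 -> q.2.[z] = z ^+ n * q.1.[z^-1],
        forall M m, (m <= M)%N -> #|lex_partitions M E lt S e m|%:R =
          iter n.+1 (@psum R) (fun i => q.1`_i) m
      & forall M m, (m <= M)%N -> #|lex_partitions M E lt' S e' m|%:R =
          iter n.+1 (@psum R) (fun i => q.2`_i) m].
Proof.
move=> lt_st lt'E; have [irr tr tot] := lt_st.
elim: n S e e' => [|n IHn] S e e' Sn edown e'E.
  have S0 : S = finset.set0 by apply/eqP; rewrite -cards_eq0 Sn.
  (* With [S] empty only the zero map remains; the constant sequence 1 is 1 / (1 - z), so both
     numerators are 1. *)
  have one M E' l d m : #|lex_partitions M E' l S d m| = 1%N.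
    apply/eqP/cards1P; exists [ffun => ord0]; apply/setP => f; rewrite [RHS]inE.
    apply/lex_partitionsP/eqP => [[h _ _]|->].
      by apply/ffunP => x; rewrite ffunE h // S0 inE.
    by split=> [x _|x|x y]; rewrite ?ffunE // S0 inE.
  exists (1, 1); split=> [i|z _|M m mM|M m mM] /=.
  - by rewrite coef1 ler0n.
  - by rewrite !hornerE.
  - rewrite one /psum big_ord_recl coef1 big1 ?addr0 // => i _.
    by rewrite coef1.
  - rewrite one /psum big_ord_recl coef1 big1 ?addr0 // => i _.
    by rewrite coef1.
have SN0 : S != finset.set0 by rewrite -cards_eq0 Sn.
(* The condition [v \in S] sits under the existential so that [fin_all_exists] can choose a pair for
   every [v]. *)
have IH v : exists q : {poly R} * {poly R}, v \in S ->
    [/\ forall i, 0 <= q.1`_i,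
        forall z : R, z != 0 -> q.2.[z] = z ^+ n * q.1.[z^-1],
        forall M m, (m <= M)%N -> #|lex_partitions M E lt (S :\ v) (lt^~ v) m|%:R =
          iter n.+1 (@psum R) (fun i => q.1`_i) m
      & forall M m, (m <= M)%N -> #|lex_partitions M E lt' (S :\ v) (lt'^~ v) m|%:R =
          iter n.+1 (@psum R) (fun i => q.2`_i) m].
  have [vS|vS] := boolP (v \in S); last by exists 0.
  have [|||q qP] := IHn (S :\ v) (lt^~ v) (lt'^~ v).
  - by have := cardsD1 v S; rewrite vS Sn => -[].
  - by move=> x y _ _ xy yv; exact: tr xy yv.
  - move=> x; rewrite !inE => /andP[xv _]; exact: strict_total_revN.
  by exists q.
have [q qP] := fin_all_exists IH.
pose sink v := [forall y in S, ~~ E v y].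
(* One summand for each possible top element [v]. The tie with the bound is forbidden at [v] by
   exactly one of [e] and [e'], so exactly one of the two numerators gains a factor z; this raises
   the exponent of the reversal from n to n + 1. *)
exists (\sum_(v in S | sink v) (if e v then (q v).1 else 'X * (q v).1),
        \sum_(v in S | sink v) (if e v then 'X * (q v).2 else (q v).2)).
split=> [i|z z0|M m mM|M m mM] /=.
- rewrite coef_sum sumr_ge0 // => v /andP[vS _]; have [q0 _ _ _] := qP v vS.
  by case: ifP => // _; rewrite coefXM; case: ifP.
- rewrite !horner_sum mulr_sumr; apply: eq_bigr => v /andP[vS _].
  have [_ qz _ _] := qP v vS.
  case: ifP => _; rewrite !(hornerM, hornerX) qz // exprS.
    by rewrite mulrA.
  by field.
- rewrite card_lex_partitions_rec // natr_sum -[RHS]/(iter n.+2 _ _ _).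
  under [X in iter _ _ X _]funext do rewrite coef_sum.
  rewrite iter_psum_sum; apply: eq_bigr => v /andP[vS _].
  have [_ _ qc _] := qP v vS.
  rewrite natr_sum (eq_bigr _ (fun j _ => qc _ _ (leq_trans (ltnSE (ltn_ord j)) mM))).
  rewrite (psum_tie (e v) (iter n.+1 (@psum R) (fun i => (q v).1`_i))).
  by case: ifP => // _; rewrite coefXM_delay [in RHS]iterS iter_psum_delay.
(* Being the complement of [e] on [S], [e'] is down-closed for the reversed order, so the recursion
   applies to it too. *)
- rewrite card_lex_partitions_rec //; first last.
  + move=> x y xS yS; rewrite lt'E !e'E // => yx; apply: contra; exact: edown.
  + exact: strict_total_rev lt_st lt'E.
  rewrite natr_sum -[RHS]/(iter n.+2 _ _ _).
  under [X in iter _ _ X _]funext do rewrite coef_sum.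
  rewrite iter_psum_sum; apply: eq_bigr => v /andP[vS _].
  have [_ _ _ qc] := qP v vS.
  rewrite natr_sum (eq_bigr _ (fun j _ => qc _ _ (leq_trans (ltnSE (ltn_ord j)) mM))).
  rewrite (psum_tie (e' v) (iter n.+1 (@psum R) (fun i => (q v).2`_i))) e'E //.
  by case: (e v) => //=; rewrite coefXM_delay -/(iter n.+2 _ _) [in RHS]iterS iter_psum_delay.
Qed.

(** * Transposing two neighbours in the tie-breaking order *)

Section Swap.
Variables (T : finType) (M : nat) (E lt lt' : rel T) (u v : T).
Hypotheses (E_irr : irreflexive E) (Evu : ~~ E v u) (uv : lt u v) (vu : lt' v u).
Hypotheses (lt_st : strict_total lt) (lt'_st : strict_total lt').
Hypothesis lt_eq : forall x y, [set x; y]%SET != [set u; v]%SET -> lt x y = lt' x y.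
Hypothesis lt_uv : forall x, x != u -> x != v -> lt x u = lt x v.
Hypothesis lt_vu : forall x, x != u -> x != v -> lt u x = lt v x.

(* E after identifying v with u. *)
Definition contract (x y : T) : bool :=
  (x != y) && [|| E x y, (x == u) && E v y | (y == u) && E x v].

Let neq_uv : u != v.
Proof. by apply/eqP => e; have [irr _ _] := lt_st; have := uv; rewrite e irr. Qed.

Let set2_eq x y : [set x; y]%SET = [set u; v]%SET ->
  x = u /\ y = v \/ x = v /\ y = u \/ x = y.
Proof.
move=> /setP h; have := h x; have := h y; rewrite !inE !eqxx orbT /=.
by do 2 (move=> /esym/orP[]/eqP ->); tauto.
Qed.

Let lt'_uv : lt' u v = false.
Proof.
have [irr tr _] := lt'_st; apply/negP => h.
by have := tr _ _ _ h vu; rewrite irr.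
Qed.

(** The two orders disagree on the pair [u], [v] alone, and [E v u] is excluded; so the only change
    is that a relation [E u v] no longer admits the tie f u = f v. *)
Let off_pair m :
  lex_partitions M E lt' [set: T] predT m =
  lex_partitions M E lt [set: T] predT m :\:
    (if E u v then [set f : {ffun T -> 'I_M.+1} | f u == f v] else finset.set0).
Proof.
apply/setP => f; rewrite [RHS]inE; apply/idP/andP.
  move=> /lex_partitionsP[h1 h2 h3]; split.
    case: ifP => Euv; rewrite inE //.
    have := h3 _ _ (finset.in_setT u) (finset.in_setT v) Euv.
    by rewrite /tie_lt lt'_uv andbF orbF -val_eqE neq_ltn => ->.
  apply/lex_partitionsP; split => // x y xT yT xy.
  have := h3 x y xT yT xy.
  have [/set2_eq[[xu yv]|[[xv yu]|xye]]|] := eqVneq [set x; y]%SET [set u; v]%SET.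
  - by rewrite xu yv lt'_uv uv /tie_lt andbF orbF => ->.
  - by rewrite xv yu (negbTE Evu) in xy.
  - by rewrite xye E_irr in xy.
  - by move=> /lt_eq ->.
move=> [fuv /lex_partitionsP[h1 h2 h3]]; apply/lex_partitionsP; split => // x y xT yT xy.
have := h3 x y xT yT xy.
have [/set2_eq[[xu yv]|[[xv yu]|xye]]|] := eqVneq [set x; y]%SET [set u; v]%SET.
- move: fuv; rewrite -xu -yv xy inE xu yv lt'_uv uv /tie_lt andbF orbF -val_eqE => fuv.
  by rewrite (negbTE fuv) orbF.
- by rewrite xv yu (negbTE Evu) in xy.
- by rewrite xye E_irr in xy.
- by move=> /lt_eq ->.
Qed.

(** When f u = f v the value at [v] is redundant. As [u] and [v] compare alike with every other
    element, each constraint on [v] turns into one on [u]. *)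
Let on_pair m : E u v ->
  #|lex_partitions M E lt [set: T] predT m :&: [set f : {ffun T -> 'I_M.+1} | f u == f v]| =
  #|lex_partitions M contract lt [set~ v] predT m|.
Proof.
move=> Euv.
pose F (f : {ffun T -> 'I_M.+1}) : {ffun T -> 'I_M.+1} :=
  [ffun x => if x == v then ord0 else f x].
rewrite -(@card_in_imset _ _ F); last first.
  move=> f g; rewrite !inE => /andP[_ /eqP fv] /andP[_ /eqP gv].
  move=> /ffunP fg; apply/ffunP => x; have := fg x; have := fg u.
  rewrite !ffunE (negbTE neq_uv); case: eqVneq => // ->.
  by rewrite fv gv.
congr #|pred_of_set _|; apply/setP => g; apply/imsetP/idP.
  move=> [f]; rewrite inE => /andP[/lex_partitionsP[_ h2 h3]].
  rewrite inE => /eqP fuv ->; apply/lex_partitionsP; split.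
  - by move=> x; rewrite !inE negbK ffunE => ->.
  - by move=> x; rewrite !inE ffunE => /negbTE ->; exact: h2.
  - move=> x y; rewrite !inE !ffunE => xv yv; rewrite (negbTE xv) (negbTE yv).
    case/andP=> xy /or3P[|/andP[/eqP xu Evy]|/andP[/eqP yu Exv]].
    + exact: h3.
    + have := h3 v y (finset.in_setT _) (finset.in_setT _) Evy.
      by rewrite xu fuv lt_vu // eq_sym -xu.
    + have := h3 x v (finset.in_setT _) (finset.in_setT _) Exv.
      by rewrite yu fuv lt_uv // -yu.
move=> /lex_partitionsP[h1 h2 h3].
have inv x : x != v -> x \in [set~ v] by rewrite !inE.
exists [ffun x => if x == v then g u else g x]; last first.
  apply/ffunP => x; rewrite !ffunE; case: eqVneq => // ->.
  by rewrite h1 // !inE eqxx.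
rewrite inE [X in _ && X]inE !ffunE eqxx (negbTE neq_uv) eqxx andbT.
apply/lex_partitionsP; split => [x|x _|x y _ _ xy]; first by rewrite inE.
  by rewrite ffunE; case: eqVneq => [_|xv]; apply: h2; rewrite ?inv // neq_uv.
rewrite !ffunE; have [xv|xv] := eqVneq x v; have [yv|yv] := eqVneq y v.
- by rewrite xv yv E_irr in xy.
- rewrite xv in xy *.
  have yu : y != u by apply: contraNneq Evu => <-.
  have := h3 u y (inv _ neq_uv) (inv _ yv); rewrite lt_vu //; apply.
  by rewrite /contract eq_sym yu eqxx xy orbT.
- rewrite yv in xy *; have [xu|xu] := eqVneq x u.
    (* The relation between [u] and [v] themselves holds as a tie, which [lt u v] admits. *)
    by rewrite xu uv /tie_lt eqxx orbT.
  have := h3 x u (inv _ xv) (inv _ neq_uv); rewrite lt_uv //; apply.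
  by rewrite /contract xu eqxx xy !orbT.
- apply: h3; rewrite ?inv // /contract xy andbT.
  by apply: contraTneq xy => ->; rewrite E_irr.
Qed.

Lemma card_lex_partitions_swap m :
  #|lex_partitions M E lt [set: T] predT m| =
  (#|lex_partitions M E lt' [set: T] predT m| +
   (if E u v then #|lex_partitions M contract lt [set~ v] predT m| else 0))%N.
Proof.
rewrite off_pair; case: ifP => [Euv|_]; last by rewrite finset.setD0 addn0.
by rewrite -on_pair // addnC finset.cardsID.
Qed.

End Swap.

(** * Bubble-sorting a linear extension into its reverse *)

Definition index_lt (T : eqType) (s : seq T) : rel T :=
  fun x y => (index x s < index y s)%N.

Lemma index_lt_strict_total (T : eqType) (s : seq T) :
  (forall x, x \in s) -> strict_total (index_lt s).
Proof.
move=> sT; rewrite /index_lt; split.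
- by move=> x; rewrite ltnn.
- by move=> y x z; exact: ltn_trans.
- move=> x y; apply: contraNT; rewrite negb_or -!leqNgt -eqn_leq => /eqP h.
  by have := nth_index x (sT x); rewrite -h nth_index // => ->.
Qed.

Lemma index_rev (T : eqType) (s : seq T) x : uniq s -> x \in s ->
  index x (rev s) = (size s - (index x s).+1)%N.
Proof.
move=> us xs; have ixs := xs; rewrite -index_mem in ixs.
have h : nth x (rev s) (size s - (index x s).+1) = x.
  rewrite nth_rev; last by lia.
  rewrite (_ : (_ - _.+1)%N = index x s) ?nth_index //; lia.
by rewrite -{1}h index_uniq ?rev_uniq // size_rev; lia.
Qed.

Lemma index_lt_rev (T : eqType) (s : seq T) x y : uniq s -> x \in s -> y \in s ->
  index_lt (rev s) x y = index_lt s y x.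
Proof.
move=> us xs ys; rewrite /index_lt !index_rev //.
move: xs ys; rewrite -!index_mem => xs ys.
by apply/idP/idP; lia.
Qed.

Section BubbleSort.
Variables (R : numFieldType) (T : finType) (E : rel T).
Hypothesis E_irr : irreflexive E.

(** The counts themselves have denominator (1 - z)^(#|T| + 1), but the difference must have
    nonnegative coefficients [r] over one power less: this is what survives the division by 1 - z
    that defines g. *)
Definition dominates (s s' : seq T) : Prop :=
  exists r : nat -> R, (forall i, 0 <= r i) /\
    forall M m, (m <= M)%N ->
      #|lex_partitions M E (index_lt s) [set: T] predT m|%:R =
      #|lex_partitions M E (index_lt s') [set: T] predT m|%:R +
      iter #|T| (@psum R) r m.

Lemma iter_psum0 k : iter k (@psum R) (fun=> 0) = fun=> 0.
Proof.
by elim: k => //= k ->; apply/funext => n; rewrite /psum big1.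
Qed.

Lemma dominates_refl s : dominates s s.
Proof. by exists (fun=> 0); split=> // M m _; rewrite iter_psum0 addr0. Qed.

Lemma dominates_trans s t w : dominates s t -> dominates t w -> dominates s w.
Proof.
move=> [r [r0 rE]] [r' [r'0 r'E]]; exists (fun i => r' i + r i); split.
  by move=> i; rewrite addr_ge0.
by move=> M m mM; rewrite rE // r'E // iter_psumD addrA.
Qed.

(** The partitions lost are those of the contraction, which has #|T| - 1 elements, so their series
    has a nonnegative numerator over (1 - z)^#|T|. Without the relation [E u v] none are lost. *)
Lemma dominates_swap s1 s2 u v : perm_eq (s1 ++ u :: v :: s2) (enum T) ->
  ~~ E v u -> dominates (s1 ++ u :: v :: s2) (s1 ++ v :: u :: s2).
Proof.
move=> sT Evu; set s := s1 ++ _; set s' := s1 ++ _.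
have ss' : perm_eq s s'.
  by rewrite perm_cat2l -(cat1s u) -(cat1s v) -(cat1s v (u :: _)) -(cat1s u s2) perm_catCA.
have us : uniq s by rewrite (perm_uniq sT) enum_uniq.
have ms x : x \in s by rewrite (perm_mem sT) mem_enum.
have ms' x : x \in s' by rewrite -(perm_mem ss').
move: us; rewrite cat_uniq /= !inE !negb_or.
move=> /and3P[_ /and3P[us1 vs1 _] /and3P[/andP[uv _] _ _]].
have iu : index u s = size s1 by rewrite index_cat (negbTE us1) /= eqxx addn0.
have iv : index v s = (size s1).+1.
  by rewrite index_cat (negbTE vs1) /= (negbTE uv) eqxx addn1.
have iu' : index u s' = (size s1).+1.
  by rewrite index_cat (negbTE us1) /= eq_sym (negbTE uv) eqxx addn1.
have iv' : index v s' = size s1 by rewrite index_cat (negbTE vs1) /= eqxx addn0.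
have ix x : x != u -> x != v -> index x s' = index x s /\
    ((index x s < size s1) || ((size s1).+1 < index x s))%N.
  move=> xu xv; rewrite !index_cat /= ![_ == x]eq_sym (negbTE xu) (negbTE xv).
  split=> //; case: ifP; first by rewrite -index_mem => ->.
  by move=> _; apply/orP; right; lia.
have lt_st := index_lt_strict_total ms; have lt'_st := index_lt_strict_total ms'.
have uvlt : index_lt s u v by rewrite /index_lt iu iv.
have vult : index_lt s' v u by rewrite /index_lt iu' iv'.
have ltu x : x != u -> x != v -> index_lt s x u = index_lt s x v.
  by move=> xu xv; rewrite /index_lt iu iv; have [_] := ix x xu xv; lia.
have ltv x : x != u -> x != v -> index_lt s u x = index_lt s v x.
  by move=> xu xv; rewrite /index_lt iu iv; have [_] := ix x xu xv; lia.
have lteq x y : [set x; y]%SET != [set u; v]%SET -> index_lt s x y = index_lt s' x y.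
  rewrite /index_lt; have [->|xu] := eqVneq x u.
    have [->|yu] := eqVneq y u; first by rewrite !ltnn.
    have [->|yv] := eqVneq y v; first by rewrite eqxx.
    by move=> _; have [->] := ix y yu yv; rewrite iu iu'; lia.
  have [->|xv] := eqVneq x v.
    have [->|yu] := eqVneq y u; first by rewrite finset.setUC eqxx.
    have [->|yv] := eqVneq y v; first by rewrite !ltnn.
    by move=> _; have [->] := ix y yu yv; rewrite iv iv'; lia.
  have [-> xb] := ix x xu xv.
  have [->|yu] := eqVneq y u; first by rewrite iu iu'; lia.
  have [->|yv] := eqVneq y v; first by rewrite iv iv'; lia.
  by have [-> _] := ix y yu yv.
have swap M m := card_lex_partitions_swap M E_irr Evu uvlt vult lt_st lt'_st lteq ltu ltv m.
move: swap; case: (E u v) => swap; last first.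
  exists (fun=> 0); split=> // M m _; rewrite iter_psum0 addr0 swap.
  by rewrite addn0.
have cT : #|[set~ v]| = #|T|.-1 by rewrite cardsC1.
have [//|//|q [q0 _ qE _]] := @lex_partitions_gf R T (contract E u v) (index_lt s)
  (fun x y => index_lt s y x) _ [set~ v] predT pred0 lt_st (fun _ _ => erefl) cT.
exists (fun i => q.1`_i); split => // M m mM.
rewrite swap natrD qE // prednK //; apply/card_gt0P; by exists u.
Qed.

Lemma dominates_move s1 x s2 s3 : perm_eq (s1 ++ x :: s2 ++ s3) (enum T) ->
  all (fun y => ~~ E y x) s2 ->
  dominates (s1 ++ x :: s2 ++ s3) (s1 ++ s2 ++ x :: s3).
Proof.
elim: s2 s1 => [|y s2 IH] s1 sT /=; first by move=> _; exact: dominates_refl.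
move=> /andP[yx s2x]; apply: dominates_trans (dominates_swap sT yx) _.
rewrite -(cat_rcons y) -[s1 ++ y :: s2 ++ _](cat_rcons y); apply: IH => //.
rewrite cat_rcons; apply: perm_trans sT.
by apply/permP => a /=; rewrite !count_cat /=; lia.
Qed.

Lemma dominates_rev s : perm_eq s (enum T) ->
  pairwise (fun x y => ~~ E y x) s -> dominates s (rev s).
Proof.
(* The tail [t] collects the elements already reversed: the head of [s] travels past the rest of [s]
   and joins [t]. *)
suff H t : perm_eq (s ++ t) (enum T) -> pairwise (fun x y => ~~ E y x) s ->
    dominates (s ++ t) (rev s ++ t).
  by have := H [::]; rewrite !cats0.
elim: s t => [|x s IH] t sT /=; first by move=> _; exact: dominates_refl.
move=> /andP[xs ps]; rewrite rev_cons cat_rcons.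
apply: dominates_trans (@dominates_move [::] x s t sT xs) (IH _ _ ps).
apply: perm_trans sT; apply/permP => a /=; rewrite !(count_cat, count_rev) /= ?count_cat; lia.
Qed.

End BubbleSort.

(** * Quotients of formal power series *)

Lemma coef_1subX_mul (R : nzRingType) (q : {poly R}) i :
  ((1 - 'X) * q)`_i = q`_i - delay (V := R) (fun j => q`_j) i.
Proof. by rewrite mulrBl mul1r coefB -(congr1 (@^~ i) (coefXM_delay q)). Qed.

Section PowerSeries.
Variable R : realType.

(** Summation by parts: the differences of the coefficients of [q] move onto [psum f] and return
    [f]. *)
Lemma fps_mul_1subX (q : {poly R}) (f : nat -> R) :
  fps_mul (fps_of_poly ((1 - 'X) * q)) (psum f) = fps_mul (fps_of_poly q) f.
Proof.
apply/funext => n; rewrite /fps_mul /fps_of_poly.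
under eq_bigr do rewrite coef_1subX_mul mulrBl.
rewrite sumrB big_ord_recr /= subnn {2}/psum big_ord1.
rewrite [X in _ - X]big_ord_recl mul0r add0r [RHS]big_ord_recr /= subnn.
rewrite addrAC; congr (_ + _); rewrite -sumrB; apply: eq_bigr => i _.
rewrite /bump /= add1n -mulrBr; congr (_ * _).
rewrite (_ : (n - i)%N = (n - i.+1).+1); last by rewrite -subSn // subSS.
by rewrite /psum big_ord_recr /= addrAC subrr add0r.
Qed.

Lemma fps_mul_iter_psum k (f : nat -> R) :
  fps_mul (fps_of_poly ((1 - 'X) ^+ k)) (iter k (@psum R) f) = f.
Proof.
elim: k => [|k IHk] /=; last by rewrite exprS fps_mul_1subX.
apply/funext => n; rewrite /fps_mul /fps_of_poly big_ord_recl /= expr0 coef1 mul1r.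
by rewrite subn0 big1 ?addr0 // => i _; rewrite coef1 mul0r.
Qed.

End PowerSeries.

(** * Interior lattice points of the dilated order polytope *)

Section OrderPolytopeInterior.
Variables (R : realType) (disp : Order.disp_t) (P : finPOrderType disp).
Variables (d : nat) (p : 'I_d -> P) (n : nat).
Hypothesis p_inj : injective p.

Lemma dilate_order_polytopeP (x : 'rV[R]_d) :
  dilate n.+1 (order_polytope R p) x <->
  (forall i, 0 <= x ord0 i <= n.+1%:R) /\
  (forall i j, (p i <= p j)%O -> x ord0 i <= x ord0 j).
Proof.
have n0 : 0 < n.+1%:R :> R by rewrite ltr0n.
split=> [[y [y01 ymon] <-]|[x0n xmon]].
  split=> [i|i j ij]; rewrite !mxE.
    have /andP[y0 y1] := y01 i; rewrite mulr_ge0 ?ler0n //=.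
    by rewrite ler_piMr // ltW.
  by rewrite ler_pM2l // ymon.
exists (n.+1%:R^-1 *: x); last by rewrite scalerA mulfV ?scale1r // gt_eqF.
split=> [i|i j ij]; rewrite !mxE.
  have /andP[x0 xn] := x0n i; rewrite mulr_ge0 ?invr_ge0 ?ler0n //=.
  by rewrite mulrC ler_pdivrMr // mul1r.
by rewrite ler_pM2l ?invr_gt0 // xmon.
Qed.

(** Moving one coordinate by half the radius of a ball around [x] makes each weak inequality strict.
    Conversely, finitely many strict inequalities persist near [x] by continuity of the
    coordinates. *)
Lemma interior_dilate_order_polytopeP (x : 'rV[R]_d) :
  (interior (dilate n.+1 (order_polytope R p))) x <->
  (forall i, 0 < x ord0 i < n.+1%:R) /\
  (forall i j, (p i < p j)%O -> x ord0 i < x ord0 j).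
Proof.
split.
  move=> /nbhs_ballP[e /= e0 xe].
  have pert i (c : R) : `|c| < e ->
      dilate n.+1 (order_polytope R p) (x + c *: delta_mx ord0 i).
    move=> ce; apply: xe; split=> [|a b]; first exact: e0.
    rewrite /ball /= !mxE opprD addNKr normrN.
    rewrite normrM; apply: le_lt_trans ce; rewrite ler_piMr //.
    by case: (_ && _); rewrite ?normr1 ?normr0.
  have e2 : `|e / 2| < e by rewrite gtr0_norm ?divr_gt0 //; lra.
  have e2' : `|- (e / 2)| < e by rewrite normrN.
  split=> [i|i j ij].
    have /dilate_order_polytopeP[/(_ i) + _] := pert i _ e2.
    have /dilate_order_polytopeP[/(_ i) + _] := pert i _ e2'.
    by rewrite !mxE !eqxx /=; lra.
  have /dilate_order_polytopeP[_ /(_ i j (ltW ij))] := pert i _ e2.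
  have ji : j == i = false by apply/eqP => ji; rewrite ji ltxx in ij.
  by rewrite !mxE !eqxx ji /=; lra.
move=> [x0n xmon]; rewrite /interior /=.
have cont (i : 'I_d) : (y ord0 i @[y --> x] --> x ord0 i)%classic.
  exact: coord_continuous.
have near1 : \forall y \near x, forall i, 0 < (y : 'rV[R]_d) ord0 i < n.+1%:R.
  apply: (@filter_forall _ _ (fun i (y : 'rV[R]_d) => 0 < y ord0 i < n.+1%:R) _ (nbhs_filter x)) => i.
  have /andP[x0 xn] := x0n i; near=> y.
  apply/andP; split; near: y.
    exact: (cont i _ (lt_nbhsr x0)).
  exact: (cont i _ (lt_nbhsl xn)).
have near2 : \forall y \near x, forall i j, (p i < p j)%O ->
    (y : 'rV[R]_d) ord0 i < y ord0 j.
  apply: (@filter_forall _ _ (fun i (y : 'rV[R]_d) => forall j, (p i < p j)%O ->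
    y ord0 i < y ord0 j) _ (nbhs_filter x)) => i.
  apply: (@filter_forall _ _ (fun j (y : 'rV[R]_d) => (p i < p j)%O ->
    y ord0 i < y ord0 j) _ (nbhs_filter x)) => j.
  have [ij|nij] := boolP (p i < p j)%O; last by near=> y.
  have xij := xmon i j ij; pose c := (x ord0 i + x ord0 j) / 2.
  have xic : x ord0 i < c by rewrite /c; lra.
  have cxj : c < x ord0 j by rewrite /c; lra.
  near=> y => _; apply: (@lt_trans _ _ c); near: y.
    exact: (cont i _ (lt_nbhsl xic)).
  exact: (cont j _ (lt_nbhsr cxj)).
near=> y; apply/dilate_order_polytopeP; split=> [i|i j].
  have /andP[y0 yn] : 0 < y ord0 i < n.+1%:R by move: i; near: y.
  by rewrite !ltW.
(* If p i = p j, injectivity gives i = j and the inequality is trivial. *)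
rewrite le_eqVlt => /orP[/eqP/p_inj -> //|ij]; apply: ltW.
by move: i j ij; near: y.
Unshelve. all: by end_near. Qed.

(** Coordinates of an interior point range over 1, ..., n; subtracting 1 gives values strictly below
    the bound n, hence [pred0]. The hypothesis on [lt] forbids ties along every relation. *)
Lemma open_ehrhart_order_polytope (lt : rel 'I_d) :
  (forall i j, (p i < p j)%O -> lt i j = false) ->
  open_ehrhart (order_polytope R p) n.+1 =
  #|lex_partitions n (fun i j => (p i < p j)%O) lt [set: 'I_d] pred0 n|.
Proof.
move=> ltF; set L := lex_partitions _ _ _ _ _ _.
pose phi (f : {ffun 'I_d -> 'I_n.+1}) : 'rV[int]_d := \row_i (f i).+1%:Z.
have phi_inj : injective phi.
  move=> f g /rowP fg; apply/ffunP => i; have := fg i; rewrite !mxE => -[] fgi.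
  exact/val_inj.
rewrite /open_ehrhart.
rewrite (_ : lattice_points _ = [set` [fset phi f | f in L]%fset])%classic.
  by rewrite set_fsetK card_imfset //= -cardE.
apply/seteqP; split=> v /=.
  move=> /interior_dilate_order_polytopeP[v0n vmon].
  have vb i : 0 < v ord0 i < n.+1%:Z.
    by have := v0n i; rewrite mxE -[n.+1%:R]/((n.+1%:Z)%:~R) ltr_int ltr0z.
  have vi i : v ord0 i = `|v ord0 i|%N by have := vb i; lia.
  have fi i : (inord `|v ord0 i|.-1 : 'I_n.+1) = `|v ord0 i|.-1 :> nat.
    by rewrite inordK //; have := vb i; lia.
  apply/imfsetP; exists [ffun i => inord `|v ord0 i|.-1] => /=; last first.
    apply/rowP => i; rewrite !mxE ffunE fi [LHS]vi; have := vb i; lia.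
  apply/lex_partitionsP; split=> [i|i _|i j _ _ ij]; first by rewrite inE.
    by rewrite ffunE fi /tie_lt andbF orbF; have := vb i; lia.
  rewrite !ffunE !fi /tie_lt ltF // andbF orbF.
  by have := vmon i j ij; rewrite !mxE ltr_int; have := vb i; have := vb j; lia.
move=> /imfsetP[f /= /lex_partitionsP[_ h2 h3] ->].
apply/interior_dilate_order_polytopeP; split=> [i|i j ij]; rewrite !mxE.
  have := h2 i (finset.in_setT i); rewrite /tie_lt andbF orbF => fi.
  by rewrite ltr0z /= -[n.+1%:R]/((n.+1%:Z)%:~R) ltr_int ltz_nat.
have := h3 i j (finset.in_setT i) (finset.in_setT j) ij.
by rewrite /tie_lt ltF // andbF orbF ltr_int ltz_nat.
Qed.

End OrderPolytopeInterior.

(** * Weak and strict order-preserving maps compared *)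

Lemma exists_linear_extension (T : finType) (E : rel T) :
  irreflexive E -> transitive E ->
  exists2 s : seq T, perm_eq s (enum T) & pairwise (fun x y => ~~ E y x) s.
Proof.
(* The number of predecessors increases strictly along [E], so sorting by it yields a linear
   extension. *)
move=> E_irr E_tr; pose rank x := #|[set y | E y x]|.
have rankE x y : E x y -> (rank x < rank y)%N.
  move=> xy; apply/proper_card/properP; split.
    by apply/fintype.subsetP => z; rewrite !inE => zx; exact: E_tr zx xy.
  by exists x; rewrite inE // E_irr.
exists (sort (relpre rank leq) (enum T)); first by rewrite perm_sort.
have : pairwise (relpre rank leq) (sort (relpre rank leq) (enum T)).
  rewrite -sorted_pairwise; last by move=> y x z; exact: leq_trans.
  by apply: sort_sorted => x y; exact: leq_total.
by apply: sub_pairwise => x y /= xy; apply/negP => /rankE; rewrite ltnNge xy.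
Qed.

Lemma strict_order_series (R : numFieldType) (T : finType) (E : rel T) :
  irreflexive E -> transitive E ->
  exists (lt : rel T) (q g q' : {poly R}),
    [/\ forall x y, E x y -> lt x y = false,
        forall m, #|lex_partitions m E lt [set: T] pred0 m|%:R =
          iter #|T|.+1 (@psum R) (fun i => q'`_i) m,
        forall z : R, z != 0 -> q'.[z] = z ^+ #|T| * q.[z^-1],
        (1 - 'X) * g = q - q'
      & forall i, 0 <= q`_i /\ 0 <= g`_i].
Proof.
move=> E_irr E_tr; have [s sT sE] := exists_linear_extension E_irr E_tr.
have us : uniq s by rewrite (perm_uniq sT) enum_uniq.
have ms x : x \in s by rewrite (perm_mem sT) mem_enum.
have lt'E x y : index_lt (rev s) x y = index_lt s y x by rewrite index_lt_rev.
have lt_st := index_lt_strict_total ms.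
have [//|//|[q q'] []] := @lex_partitions_gf R T E (index_lt s)
  (index_lt (rev s)) _ [set: T] predT pred0 lt_st lt'E (cardsT T).
rewrite /fst /snd => q0 qz qW qS.
have [r [r0 rE]] := dominates_rev R E_irr sT sE.
have ltF x y : E x y -> index_lt (rev s) x y = false.
  move=> xy; rewrite lt'E; apply/negbTE/negP => yx.
  have /(pairwiseP x) sE' := sE.
  have := sE' (index y s) (index x s); rewrite !inE !index_mem !nth_index //.
  by rewrite xy => /(_ (ms _) (ms _) yx).
(* [c] is the coefficient sequence of (q - q') / (1 - z). *)
have qq' : exists2 c : nat -> R, (forall i, 0 <= c i) &
    psum (fun i => q`_i - q'`_i) = c.
  (* Without elements, weak and strict maps coincide, so q = q' and [c] is zero. *)
  have [T0|T0] := posnP #|T|.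
    have noT (x : T) : False by have := fintype0 x; rewrite T0 => /(_ erefl).
    exists (fun=> 0) => //; rewrite (_ : (fun i => q`_i - q'`_i) = fun=> 0).
      exact: iter_psum0 1.
    have qE : (fun i => q`_i) = (fun i => q'`_i).
      apply: (@iter_psum_inj _ #|T|.+1); apply/funext => m.
      rewrite -(qW m m) // -(qS m m) //; congr (#|pred_of_set _|%:R).
      by apply: eq_lex_partitions => x; have := noT x.
    by apply/funext => i; have /= -> := congr1 (@^~ i) qE; rewrite subrr.
  (* Strict maps below m + 1 are those with values at most m, so domination reads z q = q' + z (1 -
     z) r, that is, q - q' = (1 - z) (q + z r). *)
  exists (fun i => q`_i + delay r i).
    by move=> i; rewrite addr_ge0 //; case: i => /=.
  apply: (@iter_psum_inj _ #|T|); rewrite -iterSr iter_psumB iter_psumD.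
  rewrite iter_psum_delay; apply/funext => -[|m].
    (* At 0 the delayed series vanishes, and so does the strict count, because [T] is nonempty. *)
    rewrite -(qS 0%N 0%N) //= /psum big_ord1 addr0.
    rewrite (_ : lex_partitions _ _ _ _ _ _ = finset.set0) ?cards0 ?subr0 //.
    apply/setP => f; rewrite [RHS]inE; apply/negP => /lex_partitionsP[_ h _].
    have /card_gt0P[x _] := T0.
    by have := h x (finset.in_setT x); rewrite /tie_lt andbF orbF.
  rewrite -(qS m.+1 m.+1) // (_ : lex_partitions _ _ _ _ _ _ =
    lex_partitions m.+1 E (index_lt (rev s)) [set: T] predT m).
    have := rE m.+1 m (leqnSn m); rewrite qW // => /eqP.
    rewrite addrC -subr_eq => /eqP rE'.
    rewrite -[delay _ m.+1]/(iter #|T| (@psum R) r m) -rE'.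
    by rewrite /= {1}/psum big_ord_recr /= -/(psum _ m) [in RHS]addrCA addrA.
  apply/setP => f; apply/lex_partitionsP/lex_partitionsP => -[h1 h2 h3].
    split=> // x xT; have := h2 x xT; rewrite /tie_lt andbF andbT orbF ltnS.
    by rewrite leq_eqVlt orbC.
  split=> // x xT; have := h2 x xT; rewrite /tie_lt andbF andbT orbF ltnS.
  by rewrite orbC -leq_eqVlt.
(* Reversal at z = 1 gives q(1) = q'(1), so the quotient is a polynomial. The factor extracted is X
   - 1, hence the sign of [g'] below. *)
have /factor_theorem[g' gE] : root (q - q') 1.
  by rewrite rootE hornerD hornerN qz ?oner_eq0 // expr1n mul1r invr1 subrr.
have gE' : (1 - 'X) * - g' = q - q' by rewrite gE polyC1; ring.
exists (index_lt (rev s)), q, (- g'), q'; split=> // [m|i]; first exact: qS.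
split=> //; have [c c0 cE] := qq'.
suff /(congr1 (@^~ i)) /= -> : (fun i => (- g')`_i) = c by [].
rewrite -cE -[LHS]psumK; congr psum; apply/funext => j.
by rewrite -coefB -gE' coef_1subX_mul.
Qed.

(** * The symmetric decomposition *)

Theorem theorem1p2 (R : realType) (disp : Order.disp_t)
    (P : finPOrderType disp) (d : nat) (p : 'I_d -> P) (hp : bijective p)
    (h : {poly R})
    (hh : fps_is_quotient (open_ehrhart_series (order_polytope R p))
            h ((1 - 'X) ^+ d.+1)) :
  exists a b : {poly R},
    [/\ h = a + 'X * b,
        forall z : R, z != 0 -> a.[z] = z ^+ d.+1 * a.[z^-1],
        forall z : R, z != 0 -> b.[z] = z ^+ d * b.[z^-1],
        forall i : nat, 0 <= b`_i
      & forall i : nat, 0 <= (- a)`_i].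
Proof.
have E_irr : irreflexive (fun i j => (p i < p j)%O) by move=> i; rewrite ltxx.
have E_tr : transitive (fun i j => (p i < p j)%O) by move=> j i k; exact: lt_trans.
have [lt [q [g [q']]]] := strict_order_series R E_irr E_tr.
rewrite card_ord => -[ltF qS qz gE qg0].
(* The dilate n + 1 is counted by the strict maps with bound n; this shift and the zero coefficient
   at n = 0 produce the factor z. *)
have hq : h = 'X * q'.
  have ehrE : open_ehrhart_series (order_polytope R p) =
      iter d.+1 (@psum R) (delay (fun i => q'`_i)).
    rewrite iter_psum_delay; apply/funext => -[|n] //.
    rewrite /open_ehrhart_series /= -[RHS]qS.
    by rewrite (open_ehrhart_order_polytope _ n (bij_inj hp) ltF).
  apply/polyP => i; have := congr1 (@^~ i) hh.
  rewrite /fps_is_quotient ehrE fps_mul_iter_psum -coefXM_delay.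
  by rewrite /fps_of_poly => <-.
(* Substituting 1/z in (1 - z) g = q - q' exchanges q and q' up to z^d. Cancelling 1 - z requires z
   != 1; at z = 1 the claim is trivial. *)
have gz (z : R) : z != 0 -> z * g.[z] = z ^+ d * g.[z^-1].
  move=> z0; have [->|z1] := eqVneq z 1; first by rewrite invr1 expr1n.
  have z10 : 1 - z != 0 by rewrite subr_eq0 eq_sym.
  have e1 := congr1 (horner^~ z) gE; have e2 := congr1 (horner^~ z^-1) gE.
  rewrite /= !hornerE ?invrK in e1 e2.
  rewrite qz // in e1; rewrite qz ?invr_eq0 // invrK exprVn in e2.
  apply: (mulfI z10); rewrite mulrCA e1.
  have -> : (1 - z) * (z ^+ d * g.[z^-1]) =
      - (z * z ^+ d * ((1 - z^-1) * g.[z^-1])) by field.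
  by rewrite e2; field; rewrite expf_neq0.
exists (- ('X * g)), ('X * g + q); split.
- have -> : h = 'X * (q - (1 - 'X) * g) by rewrite gE hq; ring.
  ring.
- by move=> z z0; rewrite !hornerE gz // exprS; field.
(* By both reversals, z^d b(1/z) = g(z) + q'(z), which is z g(z) + q(z) by [gE]. *)
- move=> z z0; rewrite !hornerE gz //.
  have e1 := congr1 (horner^~ z) gE; rewrite /= !hornerE qz // in e1.
  have := gz z z0; move: e1; move: (z ^+ d) => Z e1 e2.
  have -> : q.[z] = (1 - z) * g.[z] + Z * q.[z^-1] by rewrite e1; ring.
  rewrite mulrBl mul1r e2 (_ : g.[z] = z^-1 * (Z * g.[z^-1])); first by ring.
  by rewrite -e2 mulKf.
- move=> i; have [q0 g0] := qg0 i; rewrite coefD coefXM addr_ge0 //.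
  by case: i {q0 g0} => //= i; have [] := qg0 i.
- by move=> [|i]; rewrite opprK coefXM //=; have [] := qg0 i.
Qed.
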